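(* Let $A=\begin{pmatrix}a_{1,1}&a_{1,2}\\ a_{2,1}&a_{2,2}\end{pmatrix}$ be a real matrix with $\det A\ne0$, and let $\Lambda=A\mathbb{Z}^2$. Assume that $a_{1,1}\neq 0$, $a_{2,2}\ne0$ and that the numbers $$\theta=\frac{a_{1,2}}{a_{1,1}},\qquad \eta=\frac{a_{2,1}}{a_{2,2}}$$ are irrational. Then $$\omega_\Lambda\ \ge\ \mathfrak{G}_{\overline{\omega}_\Lambda}\cdot\overline{\omega}_\Lambda,$$ where, for real $y\ge 0$, $\mathfrak{G}_y$ denotes the positive root of the polynomial $\mathscr{G}_y(x)=x^2-2yx-1$.
   Context: For a two-dimensional lattice $\Lambda=A\mathbb{Z}^2\subset\mathbb{R}^2$ ($A$ a real $2\times2$ matrix with $\det A\neq0$) define $$\Psi_\Lambda(t)=\min_{x=(x_1,x_2)\in\Lambda:\ 0<\max(|x_1|,|x_2|)\le t}|x_1x_2|^{1/2}$$ for all $t$ large enough that the set is non-empty. The ordinary Diophantine exponent of the lattice is $$\omega_\Lambda=\sup\{\gamma\in\mathbb{R}:\ \liminf_{t\to\infty}t^{\gamma}\,\Psi_\Lambda(t)<\infty\},$$ and the weak uniform Diophantine exponent of the lattice is $$\overline{\omega}_\Lambda=\sup\{\gamma\in\mathbb{R}:\ \limsup_{t\to\infty}t^{\gamma}\,\Psi_\Lambda(t)<\infty\}.$$ Both exponents take values in $[0,+\infty]$. If $\overline{\omega}_\Lambda=+\infty$, the product $\mathfrak{G}_{\overline{\omega}_\Lambda}\cdot\overline{\omega}_\Lambda$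 is interpreted as $+\infty$. *)

(* Defs.v *)
From HB Require Import structures.
From mathcomp Require Import all_boot all_order all_algebra.
From mathcomp Require Import all_classical all_reals all_analysis.
From mathcomp Require Import zify ring lra.

Set Implicit Arguments.
Unset Strict Implicit.
Unset Printing Implicit Defensive.

Import Order.TTheory GRing.Theory Num.Theory.
Import numFieldNormedType.Exports.

Local Open Scope classical_set_scope.
Local Open Scope ring_scope.

Definition lattice (R : realType) (A : 'M[R]_2) : set 'cV[R]_2 :=
  [set A *m map_mx intr z | z in [set: 'cV[int]_2]].

Definition punctured_box (R : realType) (L : set 'cV[R]_2) (t : R) :
    set 'cV[R]_2 :=
  [set x | L x /\ 0 < Num.max `|x 0 0| `|x 1 0| <= t].

(* For a lattice the infimum is a minimum as soon as the punctured box is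
   nonempty, see [Psi_min]. *)
Definition Psi (R : realType) (L : set 'cV[R]_2) (t : R) : R :=
  inf [set Num.sqrt `|x 0 0 * x 1 0| | x in punctured_box L t].

Definition dioph_exponent (R : realType) (L : set 'cV[R]_2) : \bar R :=
  ereal_sup [set g%:E | g in
    [set g : R | (limf_einf (fun t : R => (t `^ g * Psi L t)%:E) +oo%R
                  < +oo)%E]].

Definition weak_uniform_exponent (R : realType) (L : set 'cV[R]_2) : \bar R :=
  ereal_sup [set g%:E | g in
    [set g : R | (limf_esup (fun t : R => (t `^ g * Psi L t)%:E) +oo%R
                  < +oo)%E]].

Definition Gpoly (R : realType) (y : R) : {poly R} :=
  'X^2 - (2 * y) *: 'X - 1.

(* The positive root exists and is unique, see [Groot_unique]; the default
   value 0 of [xget] is never used. *)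
Definition Groot (R : realType) (y : R) : R :=
  xget 0 [set x : R | 0 < x /\ root (Gpoly y) x].

(* The product of [Groot y] and [y], read as +oo at y = +oo. The value at -oo
   is immaterial: the exponents of a lattice are nonnegative. *)
Definition Groot_mul (R : realType) (y : \bar R) : \bar R :=
  match y with
  | r%:E => (Groot r * r)%:E
  | +oo%E => +oo%E
  | -oo%E => -oo%E
  end.

Lemma Groot_unique (R : realType) (y x : R) :
  0 < x /\ root (Gpoly y) x <-> x = y + Num.sqrt (y ^+ 2 + 1).
Proof.
have s2 : Num.sqrt (y ^+ 2 + 1) ^+ 2 = y ^+ 2 + 1.
  by rewrite sqr_sqrtr// addr_ge0// sqr_ge0.
have s0 : 0 <= Num.sqrt (y ^+ 2 + 1) by exact: sqrtr_ge0.
rewrite rootE /Gpoly !hornerE; move: (Num.sqrt _) s2 s0 => s s2 s0.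
split=> [[x0 /eqP h]|->].
  have /eqP : (x - y - s) * (x - y + s) = 0 by nra.
  rewrite mulf_eq0 => /orP[] /eqP e; nra.
by split; [nra | apply/eqP; nra].
Qed.

Lemma GrootE (R : realType) (y : R) : Groot y = y + Num.sqrt (y ^+ 2 + 1).
Proof.
by rewrite /Groot; case: xgetP => [x _ /Groot_unique //|/(_ _) h];
  case: (h (y + Num.sqrt (y ^+ 2 + 1))); apply/Groot_unique.
Qed.

Lemma finite_punctured_box (R : realType) (A : 'M[R]_2) (t : R) :
  \det A != 0 -> finite_set (punctured_box (lattice A) t).
Proof.
move=> dA.
have uA : A \in unitmx by rewrite unitmxE unitfE.
pose B := invmx A.
pose M := `|B 0 0| + `|B 0 1| + `|B 1 0| + `|B 1 1|.
pose N := (Num.truncn (M * t)).+1.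
pose F (p : 'I_(N + N).+1 * 'I_(N + N).+1) : 'cV[R]_2 :=
  A *m map_mx intr (\col_(i < 2)
    (if i == 0 then p.1%:Z - N%:Z else p.2%:Z - N%:Z)).
apply: (@sub_finite_set _ _ (F @` [set: _])); last first.
  by apply: finite_image; exact: finite_finset.
move=> x [[z _ <-]].
set v := A *m _ => /andP[_]; rewrite ge_max => /andP[v0 v1].
have t0 : 0 <= t by apply: le_trans v0.
have zE (i : 'I_2) : (z i 0)%:~R = B i 0 * v 0 0 + B i 1 * v 1 0 :> R.
  have -> : (z i 0)%:~R = (B *m v) i 0 :> R by rewrite /B /v mulKmx// mxE.
  by rewrite mxE big_ord_recl big_ord1/=; congr (_ * v _ _ + B _ _ * v _ _);
    exact/val_inj.
have zN (i : 'I_2) : `|z i 0| < N%:Z.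
  rewrite -(ltr_int R) intr_norm zE.
  apply: (@le_lt_trans _ _ (M * t)); last by rewrite /N truncnS_gt.
  apply: (le_trans (ler_normD _ _)); rewrite !normrM.
  have h : `|B i 0| + `|B i 1| <= M.
    have p (i' j : 'I_2) : 0 <= `|B i' j| by exact: normr_ge0.
    have := p 0 0; have := p 0 1; have := p 1 0; have := p 1 1.
    have : i = 0 \/ i = 1.
      by case: i {zE} => -[|[|//]] ?; [left|right]; exact: val_inj.
    by rewrite /M => -[] ->; lra.
  apply: le_trans (ler_wpM2r t0 h); rewrite mulrDl.
  by apply: lerD; apply: ler_wpM2l.
have zb (i : 'I_2) : (`|(z i 0 + N%:Z)%R|%N < (N + N).+1)%N.
  by have := zN i; lia.
exists (Ordinal (zb 0), Ordinal (zb 1)) => //.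
rewrite /F /v; congr (_ *m map_mx _ _); apply/colP => i; rewrite mxE /=.
have [->|->] : i = 0 \/ i = 1.
  by case: i => -[|[|//]] ?; [left|right]; exact: val_inj.
- by rewrite eqxx; have := zN 0; lia.
- by rewrite /=; have := zN 1; lia.
Qed.

Lemma Psi_min (R : realType) (A : 'M[R]_2) (t : R) :
  \det A != 0 -> punctured_box (lattice A) t !=set0 ->
  exists x, [/\ punctured_box (lattice A) t x,
    Psi (lattice A) t = Num.sqrt `|x 0 0 * x 1 0| &
    forall y, punctured_box (lattice A) t y ->
      Num.sqrt `|x 0 0 * x 1 0| <= Num.sqrt `|y 0 0 * y 1 0|].
Proof.
move=> dA [x0 Lx0]; have /finite_seqP[s Ls] := finite_punctured_box t dA.
pose f (x : 'cV[R]_2) := Num.sqrt `|x 0 0 * x 1 0|.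
have [x Lx xmin] : exists2 x, x \in s & forall y, y \in s -> f x <= f y.
  have : x0 \in s by move: Lx0; rewrite Ls.
  elim: s x0 {Ls Lx0} => // a s IH x0 _.
  have [->|[b bs]] : s = [::] \/ exists b, b \in s.
    by case: (s) => [|b ?]; [left|right; exists b; rewrite mem_head].
  - by exists a => [|y]; rewrite ?mem_head// inE => /eqP->.
  have [x xs xmin] := IH b bs.
  have [ax|xa] := leP (f a) (f x).
    exists a => [|y]; first by rewrite mem_head.
    by rewrite inE => /predU1P[->//|/xmin]; exact: le_trans.
  exists x => [|y]; first by rewrite inE xs orbT.
  by rewrite inE => /predU1P[->|/xmin//]; exact: ltW.
have xm y : punctured_box (lattice A) t y -> f x <= f y.
  by rewrite Ls; exact: xmin.
have Bx : punctured_box (lattice A) t x by rewrite Ls.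
exists x; split=> //; apply/eqP; rewrite eq_le; apply/andP; split.
  by apply: ge_inf; [exists (f x) => _ [y /xm ? <-]|exists x].
by apply: lb_le_inf; [exists (f x), x|move=> _ [y /xm ? <-]].
Qed.

(* Main.v *)
(* Write |x| for the sup norm and geo x = |x_1 x_2|^(1/2). Take lattice points
   x, y, z, each of least norm among those whose geo lies below that of its
   predecessor, with norms t0 <= t1 <= t2 as large as we like. If
   t^g Psi(t) <= C for large t, then geo x <= K t1^(-g) and geo y <= K t2^(-g).
   Two of the three points attain their norm on the same axis; they are linearly
   independent, so their determinant, at least |det A| in absolute value, is
   bounded by twice a ratio of norms times geo^2. In each of the three cases
   this yields t0 t1^(2g) <= D t2. With G = Groot g, so that G = 2g + 1/G, this
   forces t0^G <= t1 or t1^G <= D t2, hence t^(gG) Psi(t) is bounded at t = t0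
   or at t = t1. *)
Require Import Defs.
From HB Require Import structures.
From mathcomp Require Import all_boot all_order all_algebra.
From mathcomp Require Import all_classical all_reals all_analysis.
From mathcomp Require Import ring lra.

Import Order.TTheory GRing.Theory Num.Theory.
Import numFieldNormedType.Exports.
Local Open Scope classical_set_scope.
Local Open Scope ring_scope.

Set Implicit Arguments.
Unset Strict Implicit.
Unset Printing Implicit Defensive.

(** * Sup norm, geometric mean of the coordinates, and [Psi] *)

Definition supn (R : realType) (x : 'cV[R]_2) : R :=
  Num.max `|x 0 0| `|x 1 0|.

Definition geo (R : realType) (x : 'cV[R]_2) : R := Num.sqrt `|x 0 0 * x 1 0|.

Lemma ord2P (i : 'I_2) : i = 0 \/ i = 1.
Proof. by case: i => -[|[|//]] ?; [left|right]; exact: val_inj. Qed.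

Lemma sqr_geo (R : realType) (x : 'cV[R]_2) :
  geo x ^+ 2 = `|x 0 0| * `|x 1 0|.
Proof. by rewrite /geo sqr_sqrtr// normrM. Qed.

Lemma supn_axis (R : realType) (x : 'cV[R]_2) :
  exists i, supn x = `|x i 0|.
Proof. by rewrite /supn; case: leP => _; [exists 1|exists 0]. Qed.

Lemma Psi_le (R : realType) (L : set 'cV[R]_2) (t : R) (x : 'cV[R]_2) :
  L x -> 0 < supn x <= t -> Psi L t <= geo x.
Proof.
move=> Lx xt; apply: ge_inf; last by exists x.
by exists 0 => _ [y _ <-]; exact: sqrtr_ge0.
Qed.

Lemma le_Psi (R : realType) (L : set 'cV[R]_2) (t m : R) :
  punctured_box L t !=set0 ->
  (forall y, L y -> 0 < supn y <= t -> m <= geo y) -> m <= Psi L t.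
Proof.
move=> [x Lx] h; apply: lb_le_inf; first by exists (geo x), x.
by move=> _ [y [Ly yt] <-]; exact: h.
Qed.

(** * Integer coordinates and irrationality *)

Lemma latticeP (R : realType) (A : 'M[R]_2) (x : 'cV[R]_2) :
  lattice A x <-> exists u v : int,
    x 0 0 = A 0 0 * u%:~R + A 0 1 * v%:~R /\
    x 1 0 = A 1 0 * u%:~R + A 1 1 * v%:~R.
Proof.
split=> [[z _ <-]|[u [v [e0 e1]]]].
  exists (z 0 0), (z 1 0); rewrite !mxE !big_ord_recl !big_ord0 !mxE !addr0.
  by split; congr (_ + A _ _ * (z _ _)%:~R); exact: val_inj.
exists (\col_(i < 2) if i == 0 then u else v) => //.
apply/colP => i; rewrite mxE big_ord_recl big_ord1 !mxE/=.
have -> : lift ord0 (ord0 : 'I_1) = 1 :> 'I_2 by exact: val_inj.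
by case: (ord2P i) => ->; rewrite ?e0 ?e1.
Qed.

(** With [v] nonzero, the relation would make [b / a] the rational number [- u / v]. *)
Lemma irrational_affine (R : realType) (a b : R) (u v : int) :
  a != 0 -> irrational (b / a) -> a * u%:~R + b * v%:~R = 0 ->
  u = 0 /\ v = 0.
Proof.
move=> a0 irr e.
have v0 : v = 0.
  apply/eqP/negPn/negP => v0; apply: irr.
  exists (- (u%:~R / v%:~R)) => //.
  have v0' : v%:~R != 0 :> R by rewrite intr_eq0.
  rewrite rmorphN fmorph_div /= !ratr_int.
  apply: (mulIf v0'); apply: (mulfI a0).
  rewrite mulNr divfK// [RHS]mulrA (mulrC a (b / a)) divfK//; lra.
split=> //; move/eqP: e; rewrite v0 mulr0 addr0 mulf_eq0 (negbTE a0) /=.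
by rewrite intr_eq0 => /eqP.
Qed.

(** A zero coordinate is an integer relation between the entries of one row of [A]. This is what
    makes [geo] positive on nonzero lattice points. *)
Lemma lattice_coord_neq0 (R : realType) (A : 'M[R]_2) (x : 'cV[R]_2) (i : 'I_2) :
  A 0 0 != 0 -> A 1 1 != 0 ->
  irrational (A 0 1 / A 0 0) -> irrational (A 1 0 / A 1 1) ->
  lattice A x -> 0 < supn x -> x i 0 != 0.
Proof.
move=> a11 a22 ith ieta /latticeP[u [v [e0 e1]]].
apply: contraTneq => xi0.
suff [u0 v0] : u = 0 /\ v = 0.
  by rewrite /supn e0 e1 u0 v0 !mulr0 addr0 normr0 maxxx ltxx.
case: (ord2P i) xi0 => ->; rewrite ?e0 ?e1 => e.
  exact: irrational_affine a11 ith e.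
by rewrite addrC in e; have [] := irrational_affine a22 ieta e.
Qed.

(** * Determinants of pairs of lattice points *)

Lemma det2E (R : comPzRingType) (A : 'M[R]_2) :
  \det A = A 0 0 * A 1 1 - A 0 1 * A 1 0.
Proof.
rewrite (expand_det_row _ 0) !big_ord_recl big_ord0 /cofactor !det_mx11 !mxE/=.
rewrite expr0 mul1r expr1 mulN1r addr0 mulrN.
by congr (A _ _ * A _ _ - A _ _ * A _ _); exact: val_inj.
Qed.

Lemma lattice_det (R : realType) (A : 'M[R]_2) (x y : 'cV[R]_2) :
  lattice A x -> lattice A y ->
  exists n : int, x 0 0 * y 1 0 - x 1 0 * y 0 0 = \det A * n%:~R.
Proof.
move=> /latticeP[u [v [x0 x1]]] /latticeP[u' [v' [y0 y1]]].
exists (u * v' - v * u'); rewrite x0 x1 y0 y1 intrD rmorphN !intrM.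
by rewrite det2E; ring.
Qed.

(** The determinant is an integer multiple of [\det A]. Were it zero, [y] would be [l *: x] with
    [1 <= |l|] by the norms, and [geo] could not drop from [x] to [y]. *)
Lemma lattice_det_ge (R : realType) (A : 'M[R]_2) (x y : 'cV[R]_2) :
  x 0 0 != 0 ->
  lattice A x -> lattice A y ->
  supn x <= supn y -> geo y < geo x ->
  `|\det A| <= `|x 0 0 * y 1 0 - x 1 0 * y 0 0|.
Proof.
move=> x0 Lx Ly xy gyx; have [n e] := lattice_det Lx Ly.
rewrite e normrM ler_peMr// -intr_norm -[1]/(1%:~R) ler_int.
have [n0|] := eqVneq n 0; last by rewrite -normr_gt0 gtz0_ge1.
have hy : y = (y 0 0 / x 0 0) *: x.
  apply/colP => i; rewrite mxE; case: (ord2P i) => ->; first by rewrite divfK.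
  rewrite mulrAC; apply: (mulIf x0); rewrite divfK//.
  by move: e; rewrite n0 mulr0 => /eqP; rewrite subr_eq0 => /eqP; lra.
move: xy gyx; rewrite hy; move: (y 0 0 / x 0 0) => l.
rewrite /supn /geo !mxE !normrM -maxr_pMr// => xy.
have l1 : 1 <= `|l|.
  rewrite -(@ler_pM2r _ (Num.max `|x 0 0| `|x 1 0|)) ?mul1r//.
  by rewrite lt_max normr_gt0 x0.
rewrite ltNge ler_sqrt; last by do !apply: mulr_ge0.
have := ler_wpM2r (normr_ge0 (x 0 0)) l1.
have := ler_wpM2r (normr_ge0 (x 1 0)) l1.
rewrite !mul1r => h1 h0.
by rewrite ler_pM.
Qed.

(** Multiplied by [|x i 0|], each of the two terms of the determinant is at most
    [supn y * geo x ^+ 2]. *)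
Lemma lattice_same_axis (R : realType) (A : 'M[R]_2) (x y : 'cV[R]_2) (i : 'I_2) :
  x 0 0 != 0 ->
  lattice A x -> lattice A y ->
  supn x <= supn y -> geo y < geo x ->
  supn x = `|x i 0| -> supn y = `|y i 0| ->
  `|\det A| * supn x <= 2 * supn y * geo x ^+ 2.
Proof.
move=> x0 Lx Ly xy gyx ex ey.
have d := lattice_det_ge x0 Lx Ly xy gyx.
have X0 : 0 <= supn x by rewrite ex.
have p : geo y ^+ 2 <= geo x ^+ 2.
  by rewrite ler_pXn2r ?nnegrE ?sqrtr_ge0 ?ltW.
apply: le_trans (ler_wpM2r X0 d) _.
apply: le_trans (ler_wpM2r X0 (ler_normB _ _)) _.
move: p xy; rewrite !sqr_geo !normrM ex ey.
(* [a], [b] stand for the absolute coordinates of [x], [y] on the common axis, [a'], [b'] for those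
   on the other one. *)
have cross (a a' b b' : R) : 0 <= a -> 0 <= a' -> 0 <= b' -> a <= b ->
    b * b' <= a * a' -> (a * b' + a' * b) * a <= 2 * b * (a * a').
  move=> a0 a0' b0' ab p; have := ler_wpM2l a0 p.
  have := ler_wpM2l (mulr_ge0 a0 b0') ab.
  have := ler_wpM2l (mulr_ge0 a0 a0') ab; nra.
case: (ord2P i) => -> p ab; first by apply: cross => //.
rewrite addrC [X in _ <= _ * X]mulrC; apply: cross => //.
by rewrite mulrC [leRHS]mulrC.
Qed.

(** * Lattice points of least norm *)

(** The box of radius [supn z] around the origin, for any witness [z], is finite and so has a
    shortest candidate; candidates outside it are longer. *)
Lemma least_norm (R : realType) (A : 'M[R]_2) (e : R) :
  \det A != 0 ->
  (exists x, [/\ lattice A x, 0 < supn x & geo x < e]) ->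
  exists x, [/\ lattice A x, 0 < supn x, geo x < e &
    forall y, lattice A y -> 0 < supn y -> supn y < supn x ->
      e <= geo y].
Proof.
move=> dA [z [Lz z0 gz]].
have [s Ls] : exists s : seq 'cV[R]_2, punctured_box (lattice A) (supn z) = [set` s].
  by apply/finite_seqP; exact: finite_punctured_box.
pose s' := [seq x <- s | geo x < e].
have zs : z \in s'.
  rewrite mem_filter gz /=; suff : [set` s] z by [].
  by rewrite -Ls; split=> //; rewrite z0 lexx.
pose k := index z s'.
have ks : (k < size s')%N by rewrite index_mem.
case: (@arg_minP _ _ _ (Ordinal ks) xpredT (fun j : 'I_(size s') => supn (nth z s' j))) => //= j _ jmin.
have xs : nth z s' j \in s' by exact: mem_nth.
set x := nth z s' j in jmin xs *.
move: (xs); rewrite mem_filter => /andP[gx xs1].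
have : [set` s] x by [].
rewrite -Ls => -[Lx /andP[x0 xz]]; exists x; split=> // y Ly y0 yx.
rewrite leNgt; apply/negP => gy.
have ys : y \in s'.
  rewrite mem_filter gy /=; suff : [set` s] y by [].
  by rewrite -Ls; split=> //; rewrite y0 /= (le_trans (ltW yx)).
have yk : (index y s' < size s')%N by rewrite index_mem.
by have := jmin (Ordinal yk) isT; rewrite /= nth_index// leNgt yx.
Qed.

(** * Growth of norms governed by [Groot] *)

Lemma Groot_gt0 (R : realType) (y : R) : 0 < Groot y.
Proof. by have /Groot_unique[] := GrootE y. Qed.

Lemma sqr_Groot (R : realType) (y : R) : Groot y ^+ 2 = 2 * y * Groot y + 1.
Proof.
have /Groot_unique[_] := GrootE y.
rewrite rootE /Gpoly !hornerE => /eqP; lra.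
Qed.

(** Put [G = Groot g], so [G = 1/G + 2g]. If [t1 < t0^G], then [t1^(1/G) <= t0], and multiplying by
    [t1^(2g)] gives the second alternative. *)
Lemma powR_growth (R : realType) (g D t0 t1 t2 : R) :
  0 < t0 -> 0 < t1 -> t0 * t1 `^ (2 * g) <= D * t2 ->
  t0 `^ Groot g <= t1 \/ t1 `^ Groot g <= D * t2.
Proof.
move=> t00 t10 h; have G0 := Groot_gt0 g.
have [|lt1] := leP (t0 `^ Groot g) t1; [by left|right].
apply: le_trans h.
have -> : Groot g = (Groot g)^-1 + 2 * g.
  apply: (mulfI (lt0r_neq0 G0)); rewrite mulrDr mulfV ?gt_eqF//.
  by have := sqr_Groot g; rewrite expr2; lra.
rewrite powRD; last by apply/implyP => _; rewrite gt_eqF.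
apply: ler_wpM2r; first exact: powR_ge0.
have -> : t0 = (t0 `^ Groot g) `^ (Groot g)^-1.
  by rewrite -powRrM mulfV ?gt_eqF// powRr1// ltW.
by apply: ge0_ler_powR; rewrite ?nnegrE ?invr_ge0 ?powR_ge0 ?ltW.
Qed.

(** * From a uniform bound to an ordinary one *)

Lemma lattice_col0 (R : realType) (A : 'M[R]_2) :
  A 0 0 != 0 -> lattice A (col 0 A) /\ 0 < supn (col 0 A).
Proof.
move=> a11; split; last by rewrite /supn lt_max !mxE normr_gt0 a11.
by apply/latticeP; exists 1, 0; rewrite !mxE !mulr1 !mulr0 !addr0.
Qed.

(** One [K] serves every [T], so the exponent [g * Groot g] is reached with no epsilon of loss. *)
Lemma ordinary_of_uniform (R : realType) (A : 'M[R]_2) (g C T0 : R) :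
  \det A != 0 -> A 0 0 != 0 -> A 1 1 != 0 ->
  irrational (A 0 1 / A 0 0) -> irrational (A 1 0 / A 1 1) ->
  0 < g -> (forall t, T0 < t -> t `^ g * Psi (lattice A) t <= C) ->
  exists K, forall T, exists2 t, T < t &
    t `^ (g * Groot g) * Psi (lattice A) t <= K.
Proof.
move=> dA a11 a22 ith ieta g0 hC.
set L := lattice A in hC *.
have coord x i : L x -> 0 < supn x -> x i 0 != 0 by exact: lattice_coord_neq0.
have geo_gt0 x : L x -> 0 < supn x -> 0 < geo x.
  by move=> Lx x0; rewrite sqrtr_gt0 normr_gt0 mulf_neq0 ?coord.
have [Lz z0] := lattice_col0 a11; set z := col 0 A in Lz z0.
pose T1 := Num.max T0 (supn z).
have box t : T1 < t -> punctured_box L t !=set0.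
  by rewrite gt_max => /andP[_ zt]; exists z; split; rewrite ?z0 ?ltW.
have T10 : 0 < T1 by rewrite lt_max z0 orbT.
have {}hC t : T1 < t -> t `^ g * Psi L t <= C.
  by rewrite gt_max => /andP[+ _]; exact: hC.
have Psi_gt0 t : T1 < t -> 0 < Psi L t.
  by move=> /box /(Psi_min dA)[x [[Lx /andP[x0 _]] -> _]]; exact: geo_gt0.
have C0 : 0 < C.
  have T1l : T1 < T1 + 1 by rewrite ltrDl.
  apply: lt_le_trans (hC _ T1l); rewrite mulr_gt0 ?Psi_gt0// powR_gt0//; lra.
have small e : 0 < e -> exists x, [/\ L x, 0 < supn x & geo x < e].
  (* This [t] satisfies [C / e < t^g], which forces [Psi L t < e]. *)
  move=> e0; pose t := Num.max T1 ((C / e) `^ g^-1) + 1.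
  have [t1 te] : T1 < t /\ (C / e) `^ g^-1 < t.
    by split; rewrite /t ltr_pwDr// le_max lexx ?orbT.
  have [x [[Lx /andP[x0 _]] xt _]] := Psi_min dA (box _ t1).
  exists x; split=> //; rewrite /geo -xt.
  have Cet : C / e < t `^ g.
    have -> : C / e = ((C / e) `^ g^-1) `^ g.
      by rewrite -powRrM mulVf ?gt_eqF// powRr1// ltW// divr_gt0.
    by apply: gt0_ltr_powR; rewrite ?nnegrE ?powR_ge0// ltW// (lt_trans T10).
  rewrite ltr_pdivrMr// in Cet.
  have := le_lt_trans (hC _ t1) Cet.
  by rewrite ltr_pM2l// powR_gt0// (lt_trans T10).
pose K := 2 `^ g * C.
have K0 : 0 < K by rewrite mulr_gt0// powR_gt0.
(* Halving t keeps the strict bound supn y < t away from the closed box of Psi. *)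
have geo_le t m : 2 * T1 < t ->
    (forall y, L y -> 0 < supn y -> supn y < t -> m <= geo y) ->
    t `^ g * m <= K.
  move=> tT hm; have t2 : T1 < t / 2 by rewrite ltr_pdivlMr// mulrC.
  have mP : m <= Psi L (t / 2).
    apply: le_Psi; first exact: box.
    by move=> y Ly /andP[y0 yt]; apply: hm => //; lra.
  have {1}-> : t = 2 * (t / 2) by rewrite mulrC divfK.
  rewrite powRM//; last lra.
  rewrite /K -mulrA; apply: ler_wpM2l; first exact: powR_ge0.
  by apply: le_trans (hC _ t2); apply: ler_wpM2l => //; exact: powR_ge0.
pose D := 2 * K ^+ 2 / `|\det A|.
have d0 : 0 < `|\det A| by rewrite normr_gt0.
have D0 : 0 < D by rewrite divr_gt0// mulr_gt0// exprn_gt0.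
(* The first bound serves [t = supn x0], the second [t = supn x1]. *)
exists (Num.max K (D `^ g * K)) => T.
pose T2 := Num.max T (2 * T1).
have T2T1 : T1 < T2 + 1.
  rewrite ltr_pwDr// (le_trans _ (_ : 2 * T1 <= _)) ?le_max ?lexx ?orbT//; lra.
(* A point with [geo] below [Psi L (T2 + 1)] must have norm above [T2 + 1]. *)
have [x0 [Lx0 x00 gx0 min0]] := least_norm dA (small _ (Psi_gt0 _ T2T1)).
have t0T2 : T2 + 1 < supn x0.
  by rewrite ltNge; apply/negP => xT; move: gx0; rewrite ltNge Psi_le// x00.
have [x1 [Lx1 x10 gx1 min1]] := least_norm dA (small _ (geo_gt0 _ Lx0 x00)).
have [x2 [Lx2 x20 gx2 min2]] := least_norm dA (small _ (geo_gt0 _ Lx1 x10)).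
(* [x1] also meets the threshold for which [x0] is shortest. *)
have t01 : supn x0 <= supn x1.
  by rewrite leNgt; apply/negP => /(min0 _ Lx1 x10); rewrite leNgt (lt_trans gx1).
have t12 : supn x1 <= supn x2.
  by rewrite leNgt; apply/negP => /(min1 _ Lx2 x20); rewrite leNgt (lt_trans gx2).
have t0T1 : 2 * T1 < supn x0.
  apply: lt_trans t0T2; rewrite ltr_pwDr// le_max lexx orbT//.
have t0T : T < supn x0.
  by apply: lt_trans t0T2; rewrite ltr_pwDr// le_max lexx.
(* By [min1], no nonzero lattice point shorter than [x1] has [geo] below [geo x0]. *)
have g0K : supn x1 `^ g * geo x0 <= K.
  by apply: geo_le => //; exact: lt_le_trans t01.
have g1K : supn x2 `^ g * geo x1 <= K.
  by apply: geo_le => //; apply: lt_le_trans t12; exact: lt_le_trans t01.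
have sq t m : 0 <= m -> t `^ g * m <= K -> t `^ (2 * g) * m ^+ 2 <= K ^+ 2.
  move=> m0 h; rewrite [2 * g]mulrC powRrM powR_mulrn ?powR_ge0// -exprMn.
  by rewrite ler_pXn2r ?nnegrE ?mulr_ge0 ?powR_ge0// ltW.
have key : supn x0 * supn x1 `^ (2 * g) <= D * supn x2.
  (* [p] will be [geo ^+ 2] of the shorter point of the pair sharing an axis. *)
  suff [p [p0 hp Kp]] : exists p, [/\ 0 <= p,
      `|\det A| * supn x0 <= 2 * supn x2 * p &
      supn x1 `^ (2 * g) * p <= K ^+ 2].
    rewrite /D mulrAC ler_pdivlMr//.
    have := ler_wpM2r (powR_ge0 (supn x1) (2 * g)) hp.
    have := ler_wpM2l (ltW x20) Kp; lra.
  have Kp0 := sq _ _ (sqrtr_ge0 _) g0K.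
  have Kp1 := sq _ _ (sqrtr_ge0 _) g1K.
  have c0 := coord _ 0 Lx0 x00; have c1 := coord _ 0 Lx1 x10.
  have [i0 e0] := supn_axis x0.
  have [i1 e1] := supn_axis x1.
  have [i2 e2] := supn_axis x2.
  have [i01|[i02|i12]] : i0 = i1 \/ i0 = i2 \/ i1 = i2.
    by case: (ord2P i0) (ord2P i1) (ord2P i2) => -> [] -> [] ->; intuition.
  - exists (geo x0 ^+ 2); split=> //; first exact: sqr_ge0.
    rewrite -i01 in e1.
    apply: le_trans (lattice_same_axis c0 Lx0 Lx1 t01 gx1 e0 e1) _.
    by rewrite ler_wpM2r ?sqr_ge0// ler_wpM2l.
  - exists (geo x0 ^+ 2); split=> //; first exact: sqr_ge0.
    rewrite -i02 in e2; apply: (lattice_same_axis c0 Lx0 Lx2 _ _ e0 e2).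
      exact: le_trans t12.
    exact: lt_trans gx1.
  - exists (geo x1 ^+ 2); split; first exact: sqr_ge0.
      rewrite -i12 in e2.
      apply: le_trans (lattice_same_axis c1 Lx1 Lx2 t12 gx2 e1 e2).
      by rewrite ler_wpM2l.
    (* The bound for [x1] carries [supn x2], which is at least [supn x1]. *)
    apply: le_trans Kp1; rewrite ler_wpM2r ?sqr_ge0//.
    by apply: ge0_ler_powR; rewrite ?nnegrE ?mulr_ge0// ltW.
have PsiN x : L x -> 0 < supn x -> Psi L (supn x) <= geo x.
  by move=> Lx sx; apply: Psi_le => //; rewrite sx lexx.
have [h|h] := powR_growth x00 x10 key.
(* Here [t0^(gG) Psi(t0) <= t1^g geo x0]. *)
- exists (supn x0) => //; rewrite le_max; apply/orP; left.
  rewrite mulrC [g * _]mulrC powRrM mulrC; apply: le_trans g0K.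
  have P0 : 0 <= Psi L (supn x0) by rewrite ltW// Psi_gt0//; lra.
  apply: ler_pM; rewrite ?powR_ge0 ?PsiN//.
  by apply: ge0_ler_powR; rewrite ?nnegrE ?powR_ge0// ltW.
(* Here [t1^(gG) Psi(t1) <= (D t2)^g geo x1]. *)
- exists (supn x1); first exact: lt_le_trans t01.
  rewrite le_max; apply/orP; right.
  apply: le_trans (ler_wpM2l (powR_ge0 D g) g1K).
  rewrite mulrA -powRM; [|exact: ltW|exact: ltW].
  rewrite [g * _]mulrC powRrM.
  have P1 : 0 <= Psi L (supn x1) by rewrite ltW// Psi_gt0//; lra.
  apply: ler_pM; rewrite ?powR_ge0 ?PsiN//.
  by apply: ge0_ler_powR; rewrite ?nnegrE ?powR_ge0 ?mulr_ge0// ltW.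
Qed.

(** * Passage from bounds to exponents *)

Lemma limf_esup_pinfty_lt (R : realType) (f : R -> R) :
  (limf_esup (fun t => (f t)%:E) +oo%R < +oo)%E ->
  exists T C, forall t, T < t -> f t <= C.
Proof.
move=> /ereal_inf_lt[_ [V [T [_ TV]] <-] supV].
have [C fC] : exists C : R, (ereal_sup [set (f t)%:E | t in V] <= C%:E)%E.
  case: (ereal_sup _) supV => [C _||_]; [by exists C|by []|].
  by exists 0; rewrite leNye.
exists T, C => t /TV Vt; rewrite -lee_fin; apply: le_trans fC.
by apply: ereal_sup_ubound; exists t.
Qed.

Lemma limf_einf_pinfty_lt (R : realType) (f : R -> R) (K : R) :
  (forall T, exists2 t, T < t & f t <= K) ->
  (limf_einf (fun t => (f t)%:E) +oo%R < +oo)%E.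
Proof.
move=> fK; apply: (@le_lt_trans _ _ K%:E); last exact: ltry.
rewrite limf_einfE; apply: ge_ereal_sup => _ [V [T [_ TV]] <-].
have [t Tt ft] := fK T; apply: ge_ereal_inf; exists (f t)%:E.
  by exists t => //; exact: TV.
by rewrite lee_fin.
Qed.

Lemma dioph_exponent_ge (R : realType) (L : set 'cV[R]_2) (g K : R) :
  (forall T, exists2 t, T < t & t `^ g * Psi L t <= K) ->
  (g%:E <= dioph_exponent L)%E.
Proof.
move=> h; apply: ereal_sup_ubound; exists g => //=.
exact: limf_einf_pinfty_lt h.
Qed.

(** For exponent 0, [Psi] itself is bounded by [geo] of the first column of [A]. *)
Lemma dioph_exponent_ge0 (R : realType) (A : 'M[R]_2) :
  A 0 0 != 0 -> (0 <= dioph_exponent (lattice A))%E.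
Proof.
move=> /lattice_col0[]; set z := col 0 A => Lz z0.
apply: (@dioph_exponent_ge _ _ _ (geo z)) => T.
exists (Num.max T (supn z) + 1); first by rewrite ltr_pwDr// le_max lexx.
rewrite powRr0 mul1r; apply: Psi_le => //.
by rewrite z0 ler_wpDr// le_max lexx orbT.
Qed.

(* The inverse of the increasing map y |-> Groot y * y, which makes a continuity
   argument for the supremum unnecessary. *)
Lemma Groot_mul_le (R : realType) (y o : R) :
  0 <= o -> 0 < y -> (Groot y * y <= o) = (y <= o / Num.sqrt (1 + 2 * o)).
Proof.
move=> o0 y0; rewrite GrootE.
have s0 : 0 < Num.sqrt (1 + 2 * o) by rewrite sqrtr_gt0; lra.
have s2 : Num.sqrt (1 + 2 * o) ^+ 2 = 1 + 2 * o by rewrite sqr_sqrtr//; lra.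
have r0 : 0 < Num.sqrt (y ^+ 2 + 1) by rewrite sqrtr_gt0; nra.
have r2 : Num.sqrt (y ^+ 2 + 1) ^+ 2 = y ^+ 2 + 1 by rewrite sqr_sqrtr//; nra.
rewrite ler_pdivlMr//; move: (Num.sqrt _) (Num.sqrt _) r0 r2 s0 s2.
move=> s r r0 r2 s0 s2.
(* The two sides, [y r <= o - y^2] and [y s <= o], become equivalent after squaring. *)
have e : (y * r) ^+ 2 - (o - y ^+ 2) ^+ 2 = (y * s) ^+ 2 - o ^+ 2.
  by rewrite !exprMn r2 s2; ring.
have yr0 : 0 <= y * r by rewrite mulr_ge0// ltW.
have ys0 : 0 <= y * s by rewrite mulr_ge0// ltW.
apply/idP/idP => h.
  have h' : (y * r) ^+ 2 <= (o - y ^+ 2) ^+ 2.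
    by rewrite ler_pXn2r ?nnegrE//; lra.
  by rewrite -(@ler_pXn2r _ 2) ?nnegrE//; lra.
have h' : (y * s) ^+ 2 <= o ^+ 2 by rewrite ler_pXn2r ?nnegrE.
(* Needed for [o - y^2] to be nonnegative before the squares are removed. *)
have yo : y ^+ 2 <= o by move: h'; rewrite exprMn s2; nra.
suff : y * r <= o - y ^+ 2 by rewrite mulrDl -expr2; lra.
by rewrite -(@ler_pXn2r _ 2) ?nnegrE//; lra.
Qed.

(** * Comparison of the two exponents *)

Unset Implicit Arguments.
Set Strict Implicit.

Theorem theorem4 (R : realType) (A : 'M[R]_2)
  (detA : \det A != 0) (a11 : A 0 0 != 0) (a22 : A 1 1 != 0)
  (theta_irr : irrational (A 0 1 / A 0 0))
  (eta_irr : irrational (A 1 0 / A 1 1)) :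
  (Groot_mul (weak_uniform_exponent (lattice A))
     <= dioph_exponent (lattice A))%E.
Proof.
have o0 := dioph_exponent_ge0 a11.
have step g : 0 < g -> (exists T C, forall t, T < t ->
    t `^ g * Psi (lattice A) t <= C) ->
    ((Groot g * g)%:E <= dioph_exponent (lattice A))%E.
  move=> g0 [T [C hC]].
  have [K hK] := ordinary_of_uniform detA a11 a22 theta_irr eta_irr g0 hC.
  by apply: (@dioph_exponent_ge _ _ _ K); rewrite mulrC.
case: (dioph_exponent _) o0 step => [ o | |]; [|by move=> *; exact: leey|by []].
rewrite lee_fin => o0 step; pose b := o / Num.sqrt (1 + 2 * o).
have b0 : 0 <= b by rewrite divr_ge0// sqrtr_ge0.
(* Each positive admissible [g] is at most [b] by inverting [Groot g * g <= o], so the supremum is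
   too; this also excludes [+oo]. *)
have : (weak_uniform_exponent (lattice A) <= b%:E)%E.
  apply: ge_ereal_sup => _ [g /limf_esup_pinfty_lt hg <-]; rewrite lee_fin.
  have [g0|g0] := leP g 0; first exact: le_trans b0.
  by rewrite -Groot_mul_le// -lee_fin; exact: step.
case: (weak_uniform_exponent _) => [w| |_] /=; [|by []|exact: leNye].
rewrite !lee_fin => wb; have [w0|w0] := leP w 0; last by rewrite Groot_mul_le.
by apply: le_trans o0; rewrite mulr_ge0_le0// ltW// Groot_gt0.
Qed.
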